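(* Let $\mu$ and $\nu$ be two compactly supported, finite positive Borel measures on $\mathbb{C}$, each having infinite support. If $\mathcal{B}_{\mu}=\mathcal{B}_{\nu}$, then $\mathcal{A}_{\mu}=\mathcal{A}_{\nu}$.
   Context: For a finite positive measure $\mu$ on $\mathbb{C}$ with compact and infinite support, $\{p_n(z;\mu)\}_{n\ge0}$ denotes the sequence of orthonormal polynomials: $p_n(\cdot;\mu)$ has degree $n$, positive leading coefficient, and $\int p_n\overline{p_m}\,d\mu=\delta_{m,n}$. Set $R_\mu=\sup\{|z|:z\in\mathrm{supp}(\mu)\}$. The Bergman Shift matrix $M_\mu$ is the matrix of multiplication by $z$ on the closure of the polynomials in $L^2(\mu)$ in the orthonormal basis $\{p_n\}_{n\ge0}$; its rows and columns are indexed by $\{1,2,3,\ldots\}$, with $(M_\mu)_{i,k}=\int z\,p_{k-1}(z;\mu)\overline{p_{i-1}(z;\mu)}\,d\mu(z)$. For a matrix $A$ with rows and columns indexed by $\mathbb{N}$, $A_n^{(m)}$ is the $(2m+1)\times(2m+1)$ submatrix of $A$ centered at $A_{n,n}$ (defined for $n>m$). A bi-infinite matrix $X$ (indexed by $\mathbb{Z}$) is a right limit of $A$ if there is a subsequence (infinite subset) $\mathcal{N}\subseteq\mathbb{N}$ such that for every $m\in\mathbb{N}$, $\lim_{n\to\infty,\,n\in\mathcal{N}}A_n^{(m)}=X_0^{(m)}$, where $X_0^{(m)}$ is the $(2m+1)\times(2m+1)$ submatrix of $X$ centered at $X_{0,0}$. $\mathcal{B}_\mu$ is the collection of all right limits of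 $M_\mu$. $\mathcal{A}_\mu$ is the collection of analytic functions that occur as limits, uniformly on compact sets, of the sequence $\{p_{n-1}(z;\mu)/p_n(z;\mu)\}_{n\in\mathbb{N}}$ as $n\to\infty$ through a subsequence; when $\mathcal{A}_\mu$ and $\mathcal{A}_\nu$ are compared, both sets consist of functions on the common domain $\{z:|z|>\max\{R_\mu,R_\nu\}\}$. The sets $\mathcal{B}_\nu,\mathcal{A}_\nu$ are defined likewise. *)

(* Defs.v *)
From HB Require Import structures.
From mathcomp Require Import all_boot all_order all_algebra.
From mathcomp Require Import complex.
From mathcomp Require Import all_classical all_reals all_analysis.

Set Implicit Arguments.
Unset Strict Implicit.
Unset Printing Implicit Defensive.

Import Order.TTheory GRing.Theory Num.Theory.
Import numFieldNormedType.Exports.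

Local Open Scope classical_set_scope.
Local Open Scope ring_scope.

(* R[i] gets the topology of its modulus, as a normed module over itself:
   differentiability on R[i] is therefore complex differentiability. *)
HB.instance Definition _ (R : realType) := NormedModule.copy R[i] R[i]^o.

Definition borelC (R : realType) := g_sigma_algebraType (@open R[i]).

Section Definitions.
Variable R : realType.
Local Notation C := R[i].
Local Notation cmod := ComplexField.Normc.normc.

Section OneMeasure.
Variable mu : {finite_measure set (borelC R) -> \bar R}.

Definition msupport : set C :=
  [set z | forall U : set C, open U -> U z -> (0 < mu U)%E].

Definition support_radius : R := sup [set cmod z | z in msupport].

Definition cintegral (f : C -> C) : C :=
  Complex (\int[mu]_(z in setT) complex.Re (f z))
          (\int[mu]_(z in setT) complex.Im (f z)).

(* In the order of R[i], [0 < a] says that a is real and positive. *)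
Definition is_orthonormal_polys (p : nat -> {poly C}) : Prop :=
  [/\ forall n, size (p n) = n.+1,
      forall n, 0 < lead_coef (p n) &
      forall n m,
        cintegral (fun z => (p n).[z] * conjc (p m).[z]) = (n == m)%:R].

Definition orthopoly : nat -> {poly C} :=
  xget (fun=> 0) is_orthonormal_polys.

(* Rows and columns are numbered from 1; the values at index 0 are
   meaningless. *)
Definition bergman_shift (i k : nat) : C :=
  cintegral (fun z => z * (orthopoly k.-1).[z] * conjc (orthopoly i.-1).[z]).

Definition poly_ratio (n : nat) (z : C) : C :=
  (orthopoly n.-1).[z] / (orthopoly n).[z].

End OneMeasure.

(* Meaningful for m < n only. *)
Definition centered_block (A : nat -> nat -> C) (n m : nat) :
    'M[C]_(m.*2.+1) :=
  \matrix_(i, j) A (n - m + i)%N (n - m + j)%N.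

Definition centered_block0 (X : int -> int -> C) (m : nat) :
    'M[C]_(m.*2.+1) :=
  \matrix_(i, j) X (i%:Z - m%:Z) (j%:Z - m%:Z).

Definition right_limit (A : nat -> nat -> C) (X : int -> int -> C) : Prop :=
  exists2 N : set nat, infinite_set N &
    forall m : nat,
      centered_block A n m @[n --> within N \oo] --> centered_block0 X m.

Definition bergman_right_limits (mu : {finite_measure set (borelC R) -> \bar R})
    : set (int -> int -> C) :=
  [set X | right_limit (bergman_shift mu) X].

Definition analytic_on (D : set C) (f : C -> C) : Prop :=
  forall z, D z -> derivable f z 1.

(* A function on D is represented by any of its extensions to C: for open D
   membership only depends on the values on D, so two such sets are equal iff
   the corresponding sets of functions on D are. *)
Definition ratio_limits (mu : {finite_measure set (borelC R) -> \bar R})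
    (D : set C) : set (C -> C) :=
  [set f | analytic_on D f /\
    exists2 N : set nat, infinite_set N &
      forall K : set C, compact K -> K `<=` D ->
        {uniform K, poly_ratio mu n @[n --> within N \oo] --> f}].

Definition common_domain (mu nu : {finite_measure set (borelC R) -> \bar R})
    : set C :=
  [set z | Num.max (support_radius mu) (support_radius nu) < cmod z].

End Definitions.

(* Main.v *)
Require Import Defs.
From mathcomp Require Import all_boot all_order all_algebra.
From mathcomp Require Import complex ring lra zify.
From mathcomp Require Import all_classical all_reals all_analysis.
From mathcomp Require Import measurable_realfun.

(** Write M for the Bergman shift matrix of mu, M_n for its n x n truncation,
    e for the last basis row vector, and pi(z) for the row of the values at z
    of p_0, ..., p_(n-1).  Expanding z p_j in the orthonormal polynomials gives

      z pi(z) = pi(z) M_n + M_(n+1,n) p_n(z) e,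

    so p_(n-1)/p_n is the last entry of M_(n+1,n) e (z - M_n)^-1, and the
    Neumann series expresses it through the diagonal entries (M_n^k)_(n,n):

      p_(n-1)(z) / p_n(z) = sum_k M_(n+1,n) (M_n^k)_(n,n) / z^(k+1).

    Two facts make this series tell everything.

    It converges uniformly in n.  On polynomials, multiplication by z is
    bounded by the support radius R_mu in L^2(mu), hence so is every truncation
    M_n (sqnorm_shift); the truncated identity above then bounds pi(z) by a
    constant times p_n(z) when |z| >= r > R_mu (eval_row_bound), and the
    remainder after K terms is O((rho/r)^K) for any rho between R_mu and r,
    with a constant that does not depend on n (ratio_expansion).

    Its coefficients are local.  M is upper Hessenberg, so (M_n^k)_(n,n) is a
    sum over paths that stay between n-k and n, that is, a fixed polynomial in
    the entries of a block of M near (n,n) (diag_power_path_weight).  Hence the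
    coefficients converge along any subsequence that has a right limit X, and
    their limits depend on X only (right_limit_coef).

    Now let f be a limit of the ratios of mu along N.  The entries of M are
    bounded, so a diagonal extraction yields a subsequence of N with a right
    limit X (right_limit_extraction).  By hypothesis X is also a right limit
    for nu, along another subsequence.  Along both, the ratios converge to the
    series determined by X, so this series is f and f is a limit of ratios of
    nu (ratio_limits_sub).  The theorem follows by symmetry. *)

Set Implicit Arguments.
Unset Strict Implicit.
Unset Printing Implicit Defensive.

Import Order.TTheory GRing.Theory Num.Theory.
Import numFieldNormedType.Exports.
Import ComplexField.Normc.

Local Open Scope classical_set_scope.
Local Open Scope ring_scope.
Local Open Scope complex_scope.

(** * The complex plane as a metric space *)

Section ComplexModulus.
Variable R : realType.
Implicit Types x y z : R[i].

Lemma norm_normcE x : `|x| = (normc x)%:C :> R[i].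
Proof. by []. Qed.

Lemma normc_ge0 x : (0 : R) <= normc x.
Proof. by case: x => a b; apply: sqrtr_ge0. Qed.

Lemma normcB x y : normc (x - y) = normc (y - x).
Proof. by rewrite -normcN opprB. Qed.

Lemma normcX x n : normc (x ^+ n) = normc x ^+ n.
Proof. by elim: n => [|n IH]; rewrite ?expr0 ?normc1 // !exprS normcM IH. Qed.

Lemma normc_triangle x y z : normc (x - z) <= normc (x - y) + normc (y - z).
Proof. by rewrite -[x - z](subrKA y) le_normcD. Qed.

Lemma normc_Re x : `|complex.Re x| <= normc x.
Proof. by rewrite -lecR; exact: normc_ge_Re. Qed.

Lemma normc_Im x : `|complex.Im x| <= normc x.
Proof.
have := normc_Re (x * 'i%C).
by rewrite ReiNIm normrN normcM /= expr0n expr1n add0r sqrtr1 mulr1.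
Qed.

Lemma normcJ_mod x : normc (conjc x) = normc x.
Proof. by case: x => a b /=; rewrite sqrrN. Qed.

Lemma conjcM x y : conjc (x * y) = conjc x * conjc y.
Proof. exact: rmorphM. Qed.

Lemma sqr_normc_mulJ x : x * conjc x = (normc x ^+ 2)%:C.
Proof. by rewrite -sqr_normc norm_normcE rmorphXn. Qed.

(** Balls and entourages of the complex plane have radii in R[i] itself; the
    positive ones are real, which lets all convergence statements below be
    phrased with real moduli. *)
Lemma gt0_Re (e : R[i]) :
  0 < e -> 0 < complex.Re e /\ e = (complex.Re e)%:C.
Proof. by case: e => a b; rewrite ltcE /= => /andP[/eqP -> a0]. Qed.

Lemma nbhs_normcP x (A : set R[i]) :
  nbhs x A <-> exists2 e : R, 0 < e & forall y, normc (x - y) < e -> A y.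
Proof.
split=> [/nbhs_ballP[e /= e0 eA]|[e e0 eA]].
  have [re eE] := gt0_Re e0; exists (complex.Re e) => // y xy; apply: eA.
  by rewrite eE -ball_normE /ball_ /= ltcR.
apply/nbhs_ballP; exists e%:C; first by rewrite /= ltcR.
by move=> y; rewrite -ball_normE /ball_ /= ltcR => /eA.
Qed.

Lemma cvg_normcP (T : Type) (F : set_system T) (FF : Filter F)
    (u : T -> R[i]) l :
  u t @[t --> F] --> l <->
  forall e : R, 0 < e -> \forall t \near F, normc (l - u t) < e.
Proof.
split=> [ul e e0|H A /nbhs_normcP[e e0 eA]].
  by apply: (ul [set y | normc (l - y) < e]); apply/nbhs_normcP; exists e.
by apply: filterS (H e e0) => t; apply: eA.
Qed.

Lemma entourage_normcP (A : set (R[i] * R[i])) :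
  entourage A <->
  exists2 e : R, 0 < e & forall x y, normc (x - y) < e -> A (x, y).
Proof.
rewrite -entourage_ballE; split=> [[e /= e0 eA]|[e e0 eA]].
  have [re eE] := gt0_Re e0; exists (complex.Re e) => // x y xy.
  apply: eA => /=.
  by rewrite eE -ball_normE /ball_ /= ltcR.
exists e%:C; first by rewrite /= ltcR.
by move=> [x y] /=; rewrite -ball_normE /ball_ /= ltcR => /eA.
Qed.

Lemma uniform_normcP (K : set R[i]) (F : set_system nat) (FF : Filter F)
    (u : nat -> R[i] -> R[i]) f :
  {uniform K, u n @[n --> F] --> f} <->
  forall e : R, 0 < e ->
    \forall n \near F, forall z, K z -> normc (f z - u n z) < e.
Proof.
split=> [uf e e0|H A /uniform_nbhs[E [/entourage_normcP[e e0 eE] EA]]].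
  apply: (uf [set g | forall z, K z -> normc (f z - g z) < e]).
  apply/uniform_nbhs; exists [set xy | normc (xy.1 - xy.2) < e]; split=> //.
  by apply/entourage_normcP; exists e.
by apply: filterS (H _ e0) => n Hn; apply: EA => z /Hn; exact: eE.
Qed.

Lemma cvg_mxP (T : Type) (F : set_system T) (FF : Filter F) (m n : nat)
    (u : T -> 'M[R[i]]_(m, n)) (l : 'M[R[i]]_(m, n)) :
  u t @[t --> F] --> l <-> forall i j, u t i j @[t --> F] --> l i j.
Proof.
split=> [/cvg_mx_entourageP ul i j|ul].
  apply/cvg_normcP => e e0.
  have entE : entourage [set xy : R[i] * R[i] | normc (xy.1 - xy.2) < e].
    by apply/entourage_normcP; exists e.
  by apply: (@filterS _ F _ _ _ _ (ul _ entE)) => t /(_ i j); rewrite inE.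
apply/cvg_mx_entourageP => A /entourage_normcP[e e0 eA].
have H : F [set t | forall i j, normc (l i j - u t i j) < e].
  apply: filter_forall => i; apply: filter_forall => j.
  by move/cvg_normcP : (ul i j); apply.
have sub : [set t | forall i j, normc (l i j - u t i j) < e] `<=`
    u @^-1` [set v : 'M[R[i]]_(m, n) | forall i j, (l i j, v i j) \in A].
  by move=> t Ht i j; apply/mem_set; apply: eA; exact: Ht.
exact: filterS sub H.
Qed.

(** A real function that is 1-Lipschitz for the modulus is continuous; this
    covers the modulus and the real and imaginary parts at once. *)
Lemma lipschitz_normc_continuous (f : R[i] -> R) :
  (forall x y, `|f x - f y| <= normc (x - y)) -> continuous f.
Proof.
move=> lipf x A /nbhs_ballP[e /= e0 eA]; apply/nbhs_normcP; exists e => // y xy.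
by apply: eA; apply: le_lt_trans xy; exact: lipf.
Qed.

Lemma continuous_normc : continuous (@normc R).
Proof.
apply: lipschitz_normc_continuous => x y.
have h1 : normc x <= normc (x - y) + normc y.
  by rewrite -{1}(subrK y x) le_normcD.
have h2 : normc y <= normc (x - y) + normc x.
  by rewrite -{1}(subrK x y) normcB le_normcD.
rewrite ler_norml; apply/andP.
by split; [rewrite lerNl opprB|]; rewrite lerBlDr.
Qed.

Lemma continuous_Re : continuous (@complex.Re R).
Proof.
apply: lipschitz_normc_continuous => -[a b] [c d].
exact: (normc_Re (Complex a b - Complex c d)).
Qed.

Lemma continuous_Im : continuous (@complex.Im R).
Proof.
apply: lipschitz_normc_continuous => -[a b] [c d].
exact: (normc_Im (Complex a b - Complex c d)).
Qed.

Lemma continuous_conjc : continuous (@conjc R).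
Proof.
move=> x A /nbhs_normcP[e e0 eA]; apply/nbhs_normcP; exists e => // y xy.
by apply: eA; rewrite -rmorphB normcJ_mod.
Qed.

Lemma continuousC_add (f g : R[i] -> R[i]) :
  continuous f -> continuous g -> continuous (fun z => f z + g z).
Proof. by move=> cf cg x; apply: (cvgD (cf x) (cg x)). Qed.

Lemma continuousC_mul (f g : R[i] -> R[i]) :
  continuous f -> continuous g -> continuous (fun z => f z * g z).
Proof. by move=> cf cg x; apply: (cvgM (cf x) (cg x)). Qed.

Lemma continuousC_horner (p : {poly R[i]}) : continuous (fun z => p.[z]).
Proof.
elim/poly_ind: p => [|p c IH].
  rewrite (_ : (fun z => _) = cst 0); last first.
    by apply/funext => z; rewrite horner0.
  exact: cst_continuous.
rewrite (_ : (fun z => _) = (fun z => p.[z] * z + c)); last first.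
  by apply/funext => z; rewrite hornerMXaddC.
apply: continuousC_add; last exact: cst_continuous.
by apply: continuousC_mul; last by move=> x; exact: cvg_id.
Qed.

Lemma open_normc_ball (x : R[i]) (r : R) : open [set y | normc (x - y) < r].
Proof.
rewrite openE => y /= xy; apply/nbhs_normcP.
exists (r - normc (x - y)) => [|z /= yz]; first by rewrite subr_gt0.
apply: le_lt_trans (normc_triangle x y z) _.
by rewrite -ltrBrDl.
Qed.

Lemma normc_le_ReIm (x : R[i]) :
  normc x <= `|complex.Re x| + `|complex.Im x|.
Proof.
case: x => a b.
have -> : Complex a b = Complex a 0 + Complex 0 b :> R[i].
  by apply/eqP; rewrite eq_complex /= addr0 add0r !eqxx.
apply: le_trans (le_normcD _ _) _.
by rewrite /= expr0n /= !addr0 !add0r !sqrtr_sqr.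
Qed.

(** The rational balls form a countable base. *)
Lemma rational_ball (z : R[i]) (e : R) : 0 < e ->
  exists q : rat * rat * rat,
    normc (z - Complex (ratr q.1.1) (ratr q.1.2)) < ratr q.2 /\
    [set y | normc (Complex (ratr q.1.1) (ratr q.1.2) - y) < ratr q.2]
      `<=` [set y | normc (z - y) < e].
Proof.
move=> e0; case: z => x y.
have [|r] := @rat_in_itvoo R (e / 4) (e / 2); first by lra.
rewrite in_itv /= => /andP[r1 r2].
have dense (t : R) : exists q : rat, `|t - ratr q| < ratr r / 2.
  have [|q] := @rat_in_itvoo R t (t + ratr r / 2); first by lra.
  rewrite in_itv /= => /andP[q1 q2].
  by exists q; rewrite distrC ger0_norm; lra.
have [a xa] := dense x; have [b yb] := dense y.
exists (a, b, r) => /=.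
have zq : normc (Complex x y - Complex (ratr a) (ratr b)) < ratr r.
  by apply: le_lt_trans (normc_le_ReIm _) _; rewrite /=; lra.
split=> // w /= qw.
apply: le_lt_trans (normc_triangle _ (Complex (ratr a) (ratr b)) _) _.
by rewrite /= in zq *; lra.
Qed.

End ComplexModulus.

(** * A compactly supported measure lives on the disc of its support radius *)

Section Integral.
Variables (R : realType) (mu : {finite_measure set (borelC R) -> \bar R}).
Hypothesis mu_compact : compact (msupport mu).

Let rad := support_radius mu.
Let disc : set (borelC R) := [set z : R[i] | normc z <= rad].

Lemma support_radius_ge0 : 0 <= rad.
Proof.
rewrite /rad /support_radius.
have [hs|/sup_out ->//] := pselect (has_sup [set normc z | z in msupport mu]).
have [[x Sx] _] := hs.
apply: (@le_trans _ _ x); last by apply: ub_le_sup => //; case: hs.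
by case: Sx => z _ <-; exact: normc_ge0.
Qed.

Lemma msupport_sub_disc : msupport mu `<=` disc.
Proof.
move=> z Sz; apply: ub_le_sup; last by exists z.
have : compact [set normc z | z in msupport mu].
  apply: continuous_compact => //; apply: continuous_subspaceT.
  exact: continuous_normc.
move=> /compact_bounded[M [_ MA]]; exists (M + 1) => _ [y Sy <-].
apply: le_trans (ler_norm _) _; apply: (MA (M + 1)); first by rewrite ltrDl.
by exists y.
Qed.

Lemma openC_measurable (U : set R[i]) : open U -> @measurable _ (borelC R) U.
Proof. by move=> oU; apply: sub_sigma_algebra. Qed.

Lemma disc_measurable : measurable disc.
Proof.
rewrite (_ : disc = ~` [set z | rad < normc z]); last first.
  by apply/seteqP; split => z; rewrite /disc /= leNgt => /negP.
apply: measurableC; apply: openC_measurable.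
have := @open_comp _ _ (@normc R) [set x | rad < x].
by apply; [move=> x _; exact: continuous_normc|exact: open_gt].
Qed.

(** Every point outside the disc lies outside the support, so it has a
    neighbourhood of measure zero, and that neighbourhood contains a rational
    ball around the point: countably many null balls cover the complement. *)
Lemma measure_disc_compl : mu (~` disc) = 0%E.
Proof.
pose B (q : rat * rat * rat) : set (borelC R) :=
  [set y | normc (Complex (ratr q.1.1) (ratr q.1.2) - y) < ratr q.2].
(* The n-th rational ball if it is a null set, and nothing otherwise. *)
pose F n : set (borelC R) := if unpickle n is Some q
  then (if mu (B q) == 0%E then B q else set0) else set0.
have mB q : measurable (B q) by apply: openC_measurable; exact: open_normc_ball.
have nF n : mu.-negligible (F n).
  rewrite /F; case: unpickle => [q|]; last exact: negligible_set0.
  case: eqP => [B0|_]; last exact: negligible_set0.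
  by exists (B q); split; [exact: mB|exact: B0|exact: subset_refl].
have discF : ~` disc `<=` \bigcup_n F n.
  move=> z /= nz.
  have : ~ msupport mu z by move=> /msupport_sub_disc.
  move=> /existsNP[U] /not_implyP[oU] /not_implyP[Uz] /negP.
  rewrite lt0e measure_ge0 andbT negbK => /eqP U0.
  have /nbhs_normcP[e e0 eU] : nbhs z U by apply: open_nbhs_nbhs.
  have [q [zq qe]] := rational_ball z e0.
  have Bq0 : mu (B q) = 0%E.
    apply: (@subset_measure0 _ _ _ mu _ U) U0; first exact: mB.
      exact: openC_measurable.
    by move=> y /qe /eU.
  exists (pickle q); first exact: I.
  rewrite /F pickleK Bq0 eqxx.
  by rewrite /B /= normcB.
have [N [mN N0 sN]] : mu.-negligible (~` disc).
  by apply: negligibleS discF _; exact: negligible_bigcup.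
apply: subset_measure0 sN N0 => //.
by apply: measurableC; exact: disc_measurable.
Qed.

End Integral.

(** * Integration of continuous functions *)

Section CIntegral.
Variables (R : realType) (mu : {finite_measure set (borelC R) -> \bar R}).
Hypothesis mu_compact : compact (msupport mu).
Let rad := support_radius mu.
Let disc : set (borelC R) := [set z : R[i] | normc z <= rad].

(** Functions for which integration is unproblematic: polynomials, their
    conjugates and all their products qualify, and since mu is finite and lives
    on the disc, boundedness there gives integrability. *)
Definition test_function (f : R[i] -> R[i]) :=
  continuous f /\ exists B : R, forall z, normc z <= rad -> normc (f z) <= B.

Lemma test_functionD f g : test_function f -> test_function g ->
  test_function (fun z => f z + g z).
Proof.
move=> [cf [A fA]] [cg [B gB]]; split; first exact: continuousC_add.
exists (A + B) => z zr; apply: le_trans (le_normcD _ _) _.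
by apply: lerD; [exact: fA|exact: gB].
Qed.

Lemma test_functionM f g : test_function f -> test_function g ->
  test_function (fun z => f z * g z).
Proof.
move=> [cf [A fA]] [cg [B gB]]; split; first exact: continuousC_mul.
exists (A * B) => z zr; rewrite normcM.
by apply: ler_pM; [exact: normc_ge0|exact: normc_ge0|exact: fA|exact: gB].
Qed.

Lemma test_function_cst c : test_function (fun=> c).
Proof. by split; [exact: cst_continuous|exists (normc c)]. Qed.

Lemma test_function_id : test_function id.
Proof. by split; [move=> x; exact: cvg_id|exists rad]. Qed.

Lemma test_functionJ f :
  test_function f -> test_function (fun z => conjc (f z)).
Proof.
move=> [cf [A fA]]; split.
  by move=> x; apply: (continuous_comp (cf x)); exact: continuous_conjc.
by exists A => z zr; rewrite normcJ_mod; exact: fA.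
Qed.

Lemma test_function_horner (p : {poly R[i]}) : test_function (fun z => p.[z]).
Proof.
split; first exact: continuousC_horner.
elim/poly_ind: p => [|p c [B pB]].
  by exists 0 => z _; rewrite horner0 normc0.
exists (B * rad + normc c) => z zr; rewrite hornerMXaddC.
apply: le_trans (le_normcD _ _) _; rewrite lerD2r normcM.
by apply: ler_pM => //; [exact: normc_ge0|exact: normc_ge0|exact: pB].
Qed.

Lemma test_function_sum (I : Type) (s : seq I) (P : pred I)
    (F : I -> R[i] -> R[i]) :
  (forall i, test_function (F i)) ->
  test_function (fun z => \sum_(i <- s | P i) F i z).
Proof.
move=> tF; elim: s => [|i s IH].
  rewrite (_ : (fun z => _) = fun=> 0); first exact: test_function_cst.
  by apply/funext => z; rewrite big_nil.
rewrite (_ : (fun z => _) = fun z =>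
    (if P i then F i z else 0) + \sum_(j <- s | P j) F j z).
  apply: test_functionD => //.
  by case: (P i) => //; exact: test_function_cst.
by apply/funext => z; rewrite big_cons; case: ifP => //; rewrite add0r.
Qed.

Lemma continuous_measurable (g : R[i] -> R) :
  continuous g -> measurable_fun [set: borelC R] (g : borelC R -> R).
Proof.
move=> cg; apply: (measurability _ (RGenOpens.measurableE R)).
move=> _ [_ [a [b ->]] <-]; rewrite setTI; apply: openC_measurable.
apply: open_comp; first by move=> x _; exact: cg.
exact: interval_open.
Qed.

(** Off the disc there is only a null set, so values of g there, however
    large, do not prevent integrability. *)
Lemma bounded_integrable (g : R[i] -> R) (B : R) : continuous g ->
  (forall z, normc z <= rad -> `|g z| <= B) ->
  mu.-integrable setT (EFin \o (g : borelC R -> R)).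
Proof.
move=> cg gB; have mg := continuous_measurable cg.
apply/(negligible_integrable (N := ~` disc)) => //.
- by apply: measurableC; exact: disc_measurable.
- exact/measurable_EFinP.
- exact: measure_disc_compl.
rewrite setDE setTI setCK.
apply: measurable_bounded_integrable.
- exact: disc_measurable.
- by rewrite ltey_eq fin_num_measure //; exact: disc_measurable.
- exact: measurable_funS mg.
exists B; split; first by rewrite num_real.
by move=> x Bx y dy; apply: le_trans (gB y dy) (ltW Bx).
Qed.

Lemma Rintegral_disc (g : R[i] -> R) (B : R) : continuous g ->
  (forall z, normc z <= rad -> `|g z| <= B) ->
  \int[mu]_(z in setT) g z = \int[mu]_(z in disc) g z.
Proof.
move=> cg gB; have ig := bounded_integrable cg gB.
rewrite /Rintegral; congr fine.
rewrite (@negligible_integral _ _ _ _ setT (~` disc)) //.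
- by rewrite setDE setTI setCK.
- by apply: measurableC; exact: disc_measurable.
- exact: measure_disc_compl.
Qed.

Lemma test_function_Re f : test_function f ->
  continuous (fun z => complex.Re (f z)) /\
  exists B : R, forall z, normc z <= rad -> `|complex.Re (f z)| <= B.
Proof.
move=> [cf [B fB]]; split.
  by move=> x; apply: (continuous_comp (cf x)); exact: continuous_Re.
by exists B => z zr; apply: le_trans (normc_Re _) (fB z zr).
Qed.

Lemma test_function_Im f : test_function f ->
  continuous (fun z => complex.Im (f z)) /\
  exists B : R, forall z, normc z <= rad -> `|complex.Im (f z)| <= B.
Proof.
move=> [cf [B fB]]; split.
  by move=> x; apply: (continuous_comp (cf x)); exact: continuous_Im.
by exists B => z zr; apply: le_trans (normc_Im _) (fB z zr).
Qed.

Lemma integrable_Re f : test_function f ->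
  mu.-integrable setT (EFin \o (fun z : borelC R => complex.Re (f z))).
Proof.
by move=> /test_function_Re[cf [B fB]]; exact: bounded_integrable cf fB.
Qed.

Lemma integrable_Im f : test_function f ->
  mu.-integrable setT (EFin \o (fun z : borelC R => complex.Im (f z))).
Proof.
by move=> /test_function_Im[cf [B fB]]; exact: bounded_integrable cf fB.
Qed.

Lemma cintegralD f g : test_function f -> test_function g ->
  cintegral mu (fun z => f z + g z) = cintegral mu f + cintegral mu g.
Proof.
move=> tf tg; rewrite /cintegral.
have ReD z : complex.Re (f z + g z) = complex.Re (f z) + complex.Re (g z).
  by case: (f z) (g z) => [a b] [c d].
have ImD z : complex.Im (f z + g z) = complex.Im (f z) + complex.Im (g z).
  by case: (f z) (g z) => [a b] [c d].
under eq_Rintegral do rewrite ReD.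
rewrite (RintegralD _ (integrable_Re tf) (integrable_Re tg)) //.
under [X in Complex _ X]eq_Rintegral do rewrite ImD.
by rewrite (RintegralD _ (integrable_Im tf) (integrable_Im tg)).
Qed.

Lemma cintegralZ c f : test_function f ->
  cintegral mu (fun z => c * f z) = c * cintegral mu f.
Proof.
move=> tf; rewrite /cintegral; case: c => a b.
have iRe := integrable_Re tf; have iIm := integrable_Im tf.
have iZ (k : R) (g : borelC R -> R) : mu.-integrable setT (EFin \o g) ->
    mu.-integrable setT (EFin \o (fun z => k * g z)).
  by move=> ig; exact: (integrableZl measurableT k ig).
have ReM z : complex.Re (Complex a b * f z) =
    a * complex.Re (f z) - b * complex.Im (f z) by case: (f z).
have ImM z : complex.Im (Complex a b * f z) =
    a * complex.Im (f z) + b * complex.Re (f z).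
  by case: (f z) => x y /=; rewrite [LHS]addrC addrC.
under eq_Rintegral do rewrite ReM.
rewrite (RintegralB _ (iZ a _ iRe) (iZ b _ iIm)) // !RintegralZl //.
under [X in Complex _ X]eq_Rintegral do rewrite ImM.
rewrite (RintegralD _ (iZ a _ iIm) (iZ b _ iRe)) // !RintegralZl //.
Qed.

Lemma cintegralJ f : test_function f ->
  cintegral mu (fun z => conjc (f z)) = conjc (cintegral mu f).
Proof.
move=> tf; rewrite /cintegral /=; congr Complex.
  by apply: eq_Rintegral => z _; case: (f z).
rewrite -mulN1r -(RintegralZl _ _ (integrable_Im tf)) //.
by apply: eq_Rintegral => z _; rewrite mulN1r; case: (f z).
Qed.

Lemma cintegral_Re_ge0 f : test_function f ->
  (forall z, normc z <= rad -> 0 <= complex.Re (f z)) ->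
  0 <= complex.Re (cintegral mu f).
Proof.
move=> /test_function_Re[cf [B fB]] f0; rewrite /cintegral /=.
by rewrite (Rintegral_disc cf fB) Rintegral_ge0 // => z; exact: f0.
Qed.

End CIntegral.

(** * The inner product and Bessel's inequality *)

Section Inner.
Variables (R : realType) (mu : {finite_measure set (borelC R) -> \bar R}).
Hypothesis mu_compact : compact (msupport mu).
Local Notation rad := (support_radius mu).
Local Notation test := (test_function mu).

Definition inner (f g : R[i] -> R[i]) : R[i] :=
  cintegral mu (fun z => f z * conjc (g z)).

Lemma innerDl f g h : test f -> test g -> test h ->
  inner (fun z => f z + g z) h = inner f h + inner g h.
Proof.
move=> tf tg th; have tJ := test_functionJ th.
rewrite /inner -cintegralD //; [|exact: test_functionM|exact: test_functionM].
by congr cintegral; apply/funext => z; rewrite mulrDl.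
Qed.

Lemma innerZl c f g : test f -> test g ->
  inner (fun z => c * f z) g = c * inner f g.
Proof.
move=> tf tg; rewrite /inner -cintegralZ //.
  by congr cintegral; apply/funext => z; rewrite mulrA.
by apply: test_functionM => //; exact: test_functionJ.
Qed.

Lemma innerJ f g : test f -> test g -> inner g f = conjc (inner f g).
Proof.
move=> tf tg; rewrite /inner -cintegralJ //.
  by congr cintegral; apply/funext => z; rewrite conjcM conjcK mulrC.
by apply: test_functionM => //; exact: test_functionJ.
Qed.

Lemma inner_suml (n : nat) (a : nat -> R[i]) (F : nat -> R[i] -> R[i]) g :
  (forall i, test (F i)) -> test g ->
  inner (fun z => \sum_(i < n) a i * F i z) g =
  \sum_(i < n) a i * inner (F i) g.
Proof.
move=> tF tg; elim: n => [|n IH].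
  rewrite (_ : (fun z => _) = fun z => 0 * g z).
    by rewrite innerZl // mul0r big_ord0.
  by apply/funext => z; rewrite big_ord0 mul0r.
rewrite (_ : (fun z => _) = fun z => \sum_(i < n) a i * F i z + a n * F n z).
  rewrite innerDl // ?innerZl // ?IH; first by rewrite big_ord_recr.
  - apply: test_function_sum => i; apply: test_functionM => //.
    exact: test_function_cst.
  - by apply: test_functionM => //; exact: test_function_cst.
by apply/funext => z; rewrite big_ord_recr.
Qed.

Lemma inner_sumr (n : nat) (a : nat -> R[i]) (F : nat -> R[i] -> R[i]) g :
  (forall i, test (F i)) -> test g ->
  inner g (fun z => \sum_(i < n) a i * F i z) =
  \sum_(i < n) conjc (a i) * inner g (F i).
Proof.
move=> tF tg; rewrite (@innerJ (fun z => \sum_(i < n) a i * F i z)) //.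
  rewrite inner_suml // rmorph_sum; apply: eq_bigr => i _.
  by rewrite (innerJ (tF i) tg); exact: conjcM.
apply: test_function_sum => i; apply: test_functionM => //.
exact: test_function_cst.
Qed.

Lemma inner_Re_ge0 f : test f -> 0 <= complex.Re (inner f f).
Proof.
move=> tf; apply: cintegral_Re_ge0 => //.
  by apply: test_functionM => //; exact: test_functionJ.
by move=> z _; rewrite sqr_normc_mulJ /= sqr_ge0.
Qed.

Lemma inner_conj_mul f g :
  inner (fun z => z * f z) g = inner f (fun z => conjc z * g z).
Proof.
congr cintegral; apply/funext => z.
by rewrite conjcM conjcK mulrCA mulrA.
Qed.

(** Multiplication by the conjugate of z, the adjoint of multiplication by z,
    has norm at most the support radius, because |z| is at most that radius
    on the disc that carries mu. *)
Lemma inner_conj_bound f : test f ->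
  complex.Re (inner (fun z => conjc z * f z) (fun z => conjc z * f z)) <=
  rad ^+ 2 * complex.Re (inner f f).
Proof.
move=> tf.
have tff : test (fun z => f z * conjc (f z)).
  by apply: test_functionM => //; exact: test_functionJ.
have tid := test_function_id mu.
have tzz : test (fun z => - (z * conjc z)).
  rewrite (_ : (fun z => _) = fun z => (- 1) * (z * conjc z)); last first.
    by apply/funext => z; rewrite mulN1r.
  apply: test_functionM; first exact: test_function_cst.
  by apply: test_functionM => //; exact: test_functionJ.
have tw : test (fun z => (rad ^+ 2)%:C + - (z * conjc z)).
  by apply: test_functionD => //; exact: test_function_cst.
rewrite -subr_ge0.
have -> : rad ^+ 2 * complex.Re (inner f f) -
    complex.Re (inner (fun z => conjc z * f z) (fun z => conjc z * f z)) =
  complex.Re (cintegral mu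
    (fun z => ((rad ^+ 2)%:C + - (z * conjc z)) * (f z * conjc (f z)))).
  have -> : (fun z => ((rad ^+ 2)%:C + - (z * conjc z)) * (f z * conjc (f z))) =
    fun z => (rad ^+ 2)%:C * (f z * conjc (f z)) +
      (- 1) * ((conjc z * f z) * conjc (conjc z * f z)).
    by apply/funext => z; rewrite conjcM conjcK; ring.
  rewrite cintegralD ?cintegralZ //.
  - rewrite /inner; case: (cintegral mu _) => a b.
    case: (cintegral mu _) => c d.
    by rewrite /=; ring.
  - by apply: test_functionM; [|apply: test_functionJ];
      apply: test_functionM => //; exact: test_functionJ.
  - by apply: test_functionM => //; exact: test_function_cst.
  - apply: test_functionM; first exact: test_function_cst.
    by apply: test_functionM; [|apply: test_functionJ];
      apply: test_functionM => //; exact: test_functionJ.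
apply: cintegral_Re_ge0 => //; first exact: test_functionM.
move=> z zr; rewrite !sqr_normc_mulJ -rmorphB -rmorphM /=.
rewrite mulr_ge0 ?sqr_ge0 // subr_ge0.
by rewrite lerXn2r // ?nnegrE ?normc_ge0 ?support_radius_ge0.
Qed.

(** Bessel's inequality: the squared norm of f minus its orthogonal projection
    is nonnegative. *)
Lemma bessel (n : nat) (e : nat -> R[i] -> R[i]) f :
  (forall i, test (e i)) -> (forall i j, inner (e i) (e j) = (i == j)%:R) ->
  test f ->
  \sum_(j < n) normc (inner f (e j)) ^+ 2 <= complex.Re (inner f f).
Proof.
move=> te orth tf; pose a j := - inner f (e j).
pose s z := \sum_(j < n) a j * e j z.
have ts : test s.
  apply: test_function_sum => i; apply: test_functionM => //.
  exact: test_function_cst.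
pose h z := f z + s z.
have th : test h by exact: test_functionD.
have hk (k : 'I_n) : inner h (e k) = 0.
  rewrite /h innerDl // /s inner_suml // (bigD1 k) //= orth eqxx mulr1 big1.
    by rewrite addr0 /a addrN.
  by move=> i ik; rewrite orth (negbTE (ik : nat_of_ord i != k)) mulr0.
have hs : inner h s = 0.
  by rewrite /s inner_sumr // big1 // => i _; rewrite hk mulr0.
have hh : inner h h = inner f f - \sum_(j < n) (normc (inner f (e j)) ^+ 2)%:C.
  rewrite innerJ // {1}/h innerDl // (innerJ th ts) hs conjc0 addr0.
  rewrite (innerJ th tf) conjcK {1}/h innerDl // /s inner_suml // -sumrN.
  congr (_ + _); apply: eq_bigr => i _.
  by rewrite /a mulNr (innerJ tf (te i)) sqr_normc_mulJ.
have := inner_Re_ge0 th; rewrite hh -rmorph_sum /=.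
by case: (inner f f) => x y /=; rewrite subr_ge0.
Qed.

End Inner.

(** * Squared norms of row vectors and the Neumann expansion *)

Section SqnormAlgebra.
Variable R : realType.
Implicit Types (x y : R[i]) (d : R).

Definition sqnorm n (u : 'rV[R[i]]_n) : R := \sum_j normc (u 0 j) ^+ 2.

Lemma sqnorm_ge0 n (u : 'rV[R[i]]_n) : 0 <= sqnorm u.
Proof. by apply: sumr_ge0 => j _; exact: sqr_ge0. Qed.

Lemma normc_entry_le n (u : 'rV[R[i]]_n) j : normc (u 0 j) ^+ 2 <= sqnorm u.
Proof.
by rewrite /sqnorm (bigD1 j) //= lerDl; apply: sumr_ge0 => i _; exact: sqr_ge0.
Qed.

(** This replaces the triangle inequality for the square root of sqnorm: the
    factor 1 + d is harmless as long as d can be taken small. *)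
Lemma sqr_normcD_young d x y : 0 < d ->
  normc (x + y) ^+ 2 <= (1 + d) * normc x ^+ 2 + (1 + d^-1) * normc y ^+ 2.
Proof.
move=> d0; set a := normc x; set b := normc y.
have a0 : 0 <= a by exact: normc_ge0.
have b0 : 0 <= b by exact: normc_ge0.
apply: (@le_trans _ _ ((a + b) ^+ 2)).
  by rewrite lerXn2r ?nnegrE ?normc_ge0 ?addr_ge0 // le_normcD.
rewrite -subr_ge0.
have -> : (1 + d) * a ^+ 2 + (1 + d^-1) * b ^+ 2 - (a + b) ^+ 2 =
    d^-1 * (d * a - b) ^+ 2.
  by field; rewrite gt_eqF.
by rewrite mulr_ge0 ?sqr_ge0 // invr_ge0 ltW.
Qed.

Lemma sqnormD_young d n (u v : 'rV[R[i]]_n) : 0 < d ->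
  sqnorm (u + v) <= (1 + d) * sqnorm u + (1 + d^-1) * sqnorm v.
Proof.
move=> d0; rewrite /sqnorm !mulr_sumr -big_split /=.
by apply: ler_sum => j _; rewrite mxE sqr_normcD_young.
Qed.

Lemma sqnormZ n c (u : 'rV[R[i]]_n) :
  sqnorm (c *: u) = normc c ^+ 2 * sqnorm u.
Proof.
rewrite /sqnorm mulr_sumr; apply: eq_bigr => j _.
by rewrite mxE normcM exprMn.
Qed.

Lemma sqnorm_delta n (i : 'I_n) : sqnorm (delta_mx 0 i : 'rV[R[i]]_n) = 1.
Proof.
rewrite /sqnorm (bigD1 i) //= mxE !eqxx big1.
  by rewrite normc1 expr1n addr0.
by move=> k ki; rewrite mxE (negbTE ki) andbF normc0 expr0n.
Qed.

End SqnormAlgebra.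

(** The partial sums of the Neumann series of (z - A)^-1, applied to the
    solution u of the resolvent equation, with an exact remainder. *)
Lemma neumann_expansion (F : fieldType) n (A : 'M[F]_n.+1) (u e : 'rV[F]_n.+1)
    (g z : F) K :
  z != 0 -> z *: u = u *m A + g *: e ->
  u = \sum_(k < K) (g / z ^+ k.+1) *: (e *m A ^+ k) + z ^- K *: (u *m A ^+ K).
Proof.
move=> z0 uE; elim: K => [|K IH].
  by rewrite big_ord0 add0r !expr0 invr1 scale1r mulmx1.
rewrite big_ord_recr /= {1}IH -addrA; congr (_ + _).
have -> : z ^- K *: (u *m A ^+ K) = z ^- K.+1 *: ((z *: u) *m A ^+ K).
  rewrite -scalemxAl scalerA; congr (_ *: _).
  by rewrite exprS invfM mulrAC mulVf // mul1r.
rewrite uE mulmxDl scalerDr addrC -scalemxAl scalerA [_ * g]mulrC.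
by rewrite -mulmxA mulmxE -exprS.
Qed.

(** * The Bergman shift matrix and its norm *)

Section Bergman.
Variables (R : realType) (mu : {finite_measure set (borelC R) -> \bar R}).
Hypothesis mu_compact : compact (msupport mu).
Local Notation rad := (support_radius mu).
Variable p : nat -> {poly R[i]}.
Hypothesis p_orth : is_orthonormal_polys mu p.

Let pv (n : nat) (z : R[i]) : R[i] := (p n).[z].

(** The Bergman shift matrix of p with rows and columns numbered from 0, so
    that column j is that of p_j. *)
Definition shift_entry (i j : nat) : R[i] :=
  inner mu (fun z => z * (p j).[z]) (fun z => (p i).[z]).
Local Notation B := shift_entry.

Lemma orthonormal_inner i j : inner mu (pv i) (pv j) = (i == j)%:R.
Proof. by case: p_orth => _ _; apply. Qed.

Lemma orthonormal_span n (q : {poly R[i]}) : (size q <= n)%N ->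
  exists a : nat -> R[i], q = \sum_(i < n) a i *: p i.
Proof.
have [sp lp _] := p_orth.
elim: n q => [|n IH] q sq.
  by exists (fun=> 0); rewrite big_ord0; apply/eqP; rewrite -size_poly_leq0.
pose c := q`_n / lead_coef (p n).
have [|a qa] := IH (q - c *: p n).
  apply/leq_sizeP => k; rewrite leq_eqVlt => /predU1P[<-|nk].
    rewrite coefB coefZ /c lead_coefE sp /= divfK ?subrr //.
    by have := lp n; rewrite lead_coefE sp /= => /lt0r_neq0.
  rewrite coefB coefZ !nth_default ?sp // ?mulr0 ?subrr //.
  exact: leq_trans sq nk.
exists (fun i => if i == n then c else a i).
rewrite big_ord_recr /= eqxx -[LHS](subrK (c *: p n)) qa; congr (_ + _).
by apply: eq_bigr => i _; rewrite ltn_eqF.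
Qed.

Lemma inner_expansion n (a : nat -> R[i]) k :
  inner mu (fun z => (\sum_(i < n) a i *: p i).[z]) (pv k) =
  if (k < n)%N then a k else 0.
Proof.
rewrite (_ : (fun z => _) = fun z => \sum_(i < n) a i * pv i z); last first.
  apply/funext => z; rewrite horner_sum.
  by apply: eq_bigr => i _; rewrite hornerZ.
rewrite inner_suml //; try by move=> *; exact: test_function_horner.
under eq_bigr do rewrite orthonormal_inner.
case: ifP => [kn|/negbT kn].
  rewrite (bigD1 (Ordinal kn)) //= eqxx mulr1 big1 ?addr0 // => i ik.
  by rewrite (negbTE (ik : nat_of_ord i != k)) mulr0.
rewrite big1 // => i _; case: eqP => [ik|_]; last by rewrite mulr0.
by move: kn; rewrite -ik ltn_ord.
Qed.

Lemma shift_expansion j :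
  exists2 a : nat -> R[i], 'X * p j = \sum_(i < j.+2) a i *: p i &
  forall i, B i j = if (i < j.+2)%N then a i else 0.
Proof.
have [sp _ _] := p_orth.
have [|a E] := @orthonormal_span j.+2 ('X * p j).
  by rewrite mulrC size_mulX -?size_poly_eq0 ?sp.
exists a; first exact: E.
move=> i; rewrite -inner_expansion -E; congr inner.
by apply/funext => z; rewrite hornerM hornerX.
Qed.

(** z p_j has degree j + 1, so it involves no p_i with i > j + 1. *)
Lemma shift_hessenberg i j : (j.+1 < i)%N -> B i j = 0.
Proof.
by move=> ji; have [a _ ->] := shift_expansion j; rewrite ltnS leqNgt ji.
Qed.

Lemma shift_recurrence j z :
  z * pv j z = \sum_(i < j.+2) B i j * pv i z.
Proof.
have [a E Ba] := shift_expansion j.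
have := congr1 (fun q => q.[z]) E; rewrite hornerM hornerX horner_sum => ->.
by apply: eq_bigr => i _; rewrite hornerZ Ba ltn_ord.
Qed.

Definition truncated_shift n : 'M[R[i]]_n.+1 := \matrix_(i, j) B i j.

(** Row vectors are multiplied from the left, so this is a bound for the
    adjoint.  With g the polynomial whose coefficients are the conjugates of
    those of u, the entries of u *m M are the conjugates of the coefficients of
    conj(z) g along the p_j; Bessel's inequality bounds them by the norm of
    conj(z) g, hence by the support radius times the norm of g. *)
Lemma sqnorm_shift n (u : 'rV[R[i]]_n.+1) :
  sqnorm (u *m truncated_shift n) <= rad ^+ 2 * sqnorm u.
Proof.
have tp k : test_function mu (pv k) by exact: test_function_horner.
pose a k := conjc (u 0 (inord k)).
pose g z := \sum_(i < n.+1) a i * pv i z.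
have tg : test_function mu g.
  apply: test_function_sum => i; apply: test_functionM => //.
  exact: test_function_cst.
have tzg : test_function mu (fun z => conjc z * g z).
  apply: test_functionM => //; apply: test_functionJ; exact: test_function_id.
have entry (j : 'I_n.+1) : (u *m truncated_shift n) 0 j =
    conjc (inner mu (fun z => conjc z * g z) (pv j)).
  rewrite -innerJ // -inner_conj_mul inner_sumr //; last first.
    by apply: test_functionM => //; exact: test_function_id.
  rewrite mxE; apply: eq_bigr => i _; rewrite mxE /a conjcK inord_val.
  by [].
have gg : complex.Re (inner mu g g) = sqnorm u.
  rewrite {1}/g inner_suml // /sqnorm.
  rewrite (_ : \sum_(i < n.+1) _ = \sum_(j < n.+1) (normc (u 0 j) ^+ 2)%:C).
    by rewrite -rmorph_sum.
  apply: eq_bigr => i _; rewrite /g inner_sumr //.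
  rewrite (bigD1 i) //= orthonormal_inner eqxx mulr1 big1 ?addr0.
    by rewrite sqr_normc_mulJ /a normcJ_mod inord_val.
  move=> k ki; rewrite orthonormal_inner eq_sym.
  by rewrite (negbTE (ki : nat_of_ord k != i)) mulr0.
have := inner_conj_bound mu_compact tg; rewrite gg.
apply: le_trans; rewrite /sqnorm.
under eq_bigr do rewrite entry normcJ_mod.
by apply: bessel => // i j; exact: orthonormal_inner.
Qed.

Lemma sqnorm_shift_exp n k (u : 'rV[R[i]]_n.+1) :
  sqnorm (u *m truncated_shift n ^+ k) <= (rad ^+ 2) ^+ k * sqnorm u.
Proof.
elim: k => [|k IH]; first by rewrite !expr0 mulmx1 mul1r.
rewrite exprSr -mulmxE mulmxA; apply: le_trans (sqnorm_shift _) _.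
by rewrite [_ ^+ k.+1]exprS -mulrA ler_wpM2l // sqr_ge0.
Qed.

Lemma normc_shift_entry i j : normc (B i j) <= rad.
Proof.
pose n := maxn i j.
have ltn (k : nat) : (k <= n)%N -> (k < n.+1)%N by [].
pose i0 := Ordinal (ltn i (leq_maxl i j)).
pose j0 := Ordinal (ltn j (leq_maxr i j)).
pose u : 'rV[R[i]]_n.+1 := delta_mx 0 i0.
have uM : (u *m truncated_shift n) 0 j0 = B i j.
  by rewrite -rowE !mxE.
have u1 : sqnorm u = 1 by exact: sqnorm_delta.
have := normc_entry_le (u *m truncated_shift n) j0.
rewrite uM => /le_trans/(_ (sqnorm_shift u)); rewrite u1 mulr1.
by rewrite ler_pXn2r // nnegrE ?normc_ge0 ?support_radius_ge0.
Qed.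

End Bergman.

(** * Ratios of orthonormal polynomials as resolvent entries *)

Section Resolvent.
Variables (R : realType) (mu : {finite_measure set (borelC R) -> \bar R}).
Hypothesis mu_compact : compact (msupport mu).
Local Notation rad := (support_radius mu).
Variable p : nat -> {poly R[i]}.
Hypothesis p_orth : is_orthonormal_polys mu p.
Local Notation B := (shift_entry mu p).
Local Notation M := (truncated_shift mu p).

Definition eval_row n z : 'rV[R[i]]_n.+1 := \row_j (p j).[z].
Local Notation last_row n := (delta_mx 0 ord_max : 'rV[R[i]]_n.+1).

Lemma shift_recurrence_wide j d z :
  z * (p j).[z] = \sum_(i < j.+2 + d) B i j * (p i).[z].
Proof.
elim: d => [|d IH]; first by rewrite addn0; exact: shift_recurrence.
rewrite addnS big_ord_recr /= -IH (shift_hessenberg mu_compact p_orth).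
  by rewrite mul0r addr0.
by rewrite ltnS leq_addr.
Qed.

Lemma eval_row_eq n z :
  z *: eval_row n z =
  eval_row n z *m M n + (B n.+1 n * (p n.+1).[z]) *: last_row n.
Proof.
apply/rowP => j; rewrite !mxE eqxx /=.
have jn : (j.+2 + (n - j) = n.+2)%N by have := ltn_ord j; lia.
rewrite (shift_recurrence_wide j (n - j)) jn big_ord_recr /=; congr (_ + _).
  by apply: eq_bigr => i _; rewrite !mxE mulrC.
case: eqVneq => [->|jl] /=; first by rewrite mulr1.
rewrite (shift_hessenberg mu_compact p_orth) ?mul0r ?mulr0 // ltnS.
by rewrite ltn_neqAle -ltnS ltn_ord andbT; exact: jl.
Qed.

(** Taking norms in eval_row_eq gives |z| |pi| <= rho |pi| + rho |p_(n+1)(z)|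
    for the row pi of values; as |z| >= r > rho, the first term on the right
    can be absorbed. *)
Lemma eval_row_bound (rho r : R) : rad <= rho -> 0 < rho -> rho < r ->
  exists2 C : R, 0 <= C & forall n z, r <= normc z ->
    sqnorm (eval_row n z) <= C * normc (p n.+1).[z] ^+ 2.
Proof.
move=> rad_rho rho0 rho_r.
(* This d makes (1 + d) rho^2 the mean of r^2 and rho^2, so that half of the
   gap r^2 - rho^2 is left on the other side. *)
pose d := (r ^+ 2 - rho ^+ 2) / (2 * rho ^+ 2).
have rho2 : 0 < rho ^+ 2 by exact: exprn_gt0.
have gap : 0 < r ^+ 2 - rho ^+ 2.
  by rewrite subr_gt0 ltrXn2r // ?nnegrE ltW // (lt_trans rho0).
have d0 : 0 < d by rewrite divr_gt0 // mulr_gt0.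
have dE : (1 + d) * rho ^+ 2 = (r ^+ 2 + rho ^+ 2) / 2.
  by rewrite /d; field; rewrite gt_eqF.
pose h := (r ^+ 2 - rho ^+ 2) / 2.
have h0 : 0 < h by rewrite divr_gt0.
exists ((1 + d^-1) * rho ^+ 2 / h).
  rewrite divr_ge0 ?(ltW h0) // mulr_ge0 ?(ltW rho2) // addr_ge0 //.
  by rewrite invr_ge0 ltW.
move=> n z rz.
have := congr1 (@sqnorm R n.+1) (eval_row_eq n z).
rewrite sqnormZ => E.
have := sqnormD_young (eval_row n z *m M n)
  ((B n.+1 n * (p n.+1).[z]) *: last_row n) d0.
rewrite -E sqnormZ sqnorm_delta mulr1 normcM exprMn.
set P := sqnorm _; set Q := normc (p n.+1).[z] ^+ 2.
have P0 : 0 <= P by exact: sqnorm_ge0.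
have Q0 : 0 <= Q by exact: sqr_ge0.
have rad0 := support_radius_ge0 mu.
have radrho : rad ^+ 2 <= rho ^+ 2 by rewrite lerXn2r // nnegrE ?(ltW rho0).
have sP : sqnorm (eval_row n z *m M n) <= rho ^+ 2 * P.
  apply: le_trans (sqnorm_shift mu_compact p_orth _) _.
  exact: ler_wpM2r.
have sB : normc (B n.+1 n) ^+ 2 * Q <= rho ^+ 2 * Q.
  apply: ler_wpM2r => //; apply: le_trans radrho.
  rewrite lerXn2r ?nnegrE ?normc_ge0 //.
  exact: (normc_shift_entry mu_compact p_orth).
have rz2 : r ^+ 2 * P <= normc z ^+ 2 * P.
  apply: ler_wpM2r => //; rewrite lerXn2r ?nnegrE ?normc_ge0 //.
  by rewrite (le_trans _ (ltW rho_r)) // ltW.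
have d1 : 0 <= 1 + d by rewrite addr_ge0 // ltW.
have d2 : 0 <= 1 + d^-1 by rewrite addr_ge0 // invr_ge0 ltW.
move=> H; rewrite mulrAC ler_pdivlMr //.
have H1 := ler_wpM2l d1 sP; have H2 := ler_wpM2l d2 sB.
rewrite [X in _ <= X]mulrA dE in H1; rewrite [X in _ <= X]mulrA in H2.
by rewrite /h; lra.
Qed.

(** If p_(n+1)(z) were 0, eval_row_bound would force p_0(z) = 0, but p_0 is a
    nonzero constant.  So the zeros lie in the disc of the support radius. *)
Lemma orthonormal_eval_neq0 (z : R[i]) n : rad < normc z -> (p n.+1).[z] != 0.
Proof.
move=> rz; pose rho := (rad + normc z) / 2.
have rad0 := support_radius_ge0 mu.
have [|||C C0 /(_ n z (lexx _))] := @eval_row_bound rho (normc z).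
- by rewrite /rho; lra.
- by rewrite /rho; lra.
- by rewrite /rho; lra.
apply: contraTN => /eqP ->; rewrite normc0 expr0n mulr0 -ltNge.
apply: lt_le_trans (normc_entry_le _ 0).
rewrite mxE /= exprn_gt0 // lt_neqAle normc_ge0 andbT eq_sym.
apply/eqP => /eq0_normc /eqP.
have [sp lp _] := p_orth; have := lp 0%N; rewrite lead_coefE sp /=.
have /size_poly1P[c c0 ->] : size (p 0) == 1%N by rewrite sp.
by rewrite hornerC coefC /= => _; rewrite (negbTE c0).
Qed.

Lemma eval_row_neumann n z K : z != 0 ->
  eval_row n z =
    \sum_(k < K) (B n.+1 n * (p n.+1).[z] / z ^+ k.+1) *:
      (last_row n *m M n ^+ k)
    + z ^- K *: (eval_row n z *m M n ^+ K).
Proof. by move=> z0; apply: neumann_expansion z0 (eval_row_eq n z). Qed.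

Definition diag_power n k : R[i] := (M n ^+ k) ord_max ord_max.

(** The constant C is uniform in n: this is what allows limits in n to be
    taken term by term in the series. *)
Lemma ratio_expansion (rho r : R) : rad <= rho -> 0 < rho -> rho < r ->
  exists2 C : R, 0 <= C & forall n K z, r <= normc z ->
    normc ((p n).[z] / (p n.+1).[z] -
           \sum_(k < K) B n.+1 n * diag_power n k / z ^+ k.+1) ^+ 2
    <= C * ((rho / r) ^+ K) ^+ 2.
Proof.
move=> rad_rho rho0 rho_r.
have [C C0 HC] := eval_row_bound rad_rho rho0 rho_r.
exists C => // n K z rz.
have r0 : 0 < r by exact: lt_trans rho_r.
have zr : 0 < normc z by exact: lt_le_trans rz.
have z0 : z != 0 by apply: contraTneq zr => ->; rewrite normc0 ltxx.
have pz : (p n.+1).[z] != 0.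
  apply: orthonormal_eval_neq0.
  exact: le_lt_trans rad_rho (lt_le_trans rho_r rz).
have q0 : 0 < normc (p n.+1).[z].
  rewrite lt_neqAle normc_ge0 andbT eq_sym.
  by apply/eqP => /eq0_normc/eqP; apply/negP.
have := congr1 (fun u : 'rV[R[i]]_n.+1 => u 0 ord_max)
  (eval_row_neumann n K z0).
rewrite /= [LHS]mxE [RHS]mxE [X in _ + X]mxE summxE => E.
rewrite (_ : _ - _ =
    z ^- K * (eval_row n z *m M n ^+ K) 0 ord_max / (p n.+1).[z]); last first.
  rewrite E mulrDl addrAC mulr_suml -sumrB big1 ?add0r // => k _.
  rewrite mxE -rowE mxE /diag_power -[X in _ - X](mulfK pz).
  by rewrite -mulrBl [X in _ - X](_ : _ =
    B n.+1 n * (p n.+1).[z] / z ^+ k.+1 * (M n ^+ k) ord_max ord_max);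
    [rewrite subrr mul0r|ring].
rewrite !normcM !normcV normcX exprMn exprMn.
have H1 : normc ((eval_row n z *m M n ^+ K) 0 ord_max) ^+ 2 <=
    (rho ^+ K) ^+ 2 * (C * normc (p n.+1).[z] ^+ 2).
  apply: le_trans (normc_entry_le _ _) _.
  apply: le_trans (sqnorm_shift_exp mu_compact p_orth _ _) _.
  rewrite -!exprM mulnC; apply: ler_pM.
  - by rewrite exprn_ge0 // support_radius_ge0.
  - exact: sqnorm_ge0.
  - by rewrite lerXn2r ?nnegrE ?(ltW rho0) ?support_radius_ge0.
  - exact: HC.
rewrite expr_div_n.
have H2 : (normc z ^+ K)^-1 ^+ 2 <= (r ^+ K)^-1 ^+ 2.
  by rewrite lerXn2r ?nnegrE ?invr_ge0 ?exprn_ge0 ?normc_ge0 ?(ltW r0) //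
     lef_pV2 ?posrE ?exprn_gt0 // lerXn2r ?nnegrE ?normc_ge0 // ltW.
have q2 : 0 < normc (p n.+1).[z] ^+ 2 by exact: exprn_gt0.
rewrite [X in _ * X]exprVn ler_pdivrMr //.
have -> : C * (rho ^+ K / r ^+ K) ^+ 2 * normc (p n.+1).[z] ^+ 2 =
   (r ^+ K)^-1 ^+ 2 * ((rho ^+ K) ^+ 2 * (C * normc (p n.+1).[z] ^+ 2)).
  by rewrite exprMn; ring.
by apply: ler_pM; [exact: sqr_ge0|exact: sqr_ge0|exact: H2|exact: H1].
Qed.

End Resolvent.

(** * Locality of the coefficients *)

Section PathWeight.
Variable R : realType.
Implicit Types A : nat -> nat -> R[i].

(** Weighted paths of length k from 0 to s: the sum over t_1, ..., t_(k-1) of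
    A 0 t_1 * A t_1 t_2 * ... * A t_(k-1) s, where t_i <= i.  When A t s = 0 for
    s > t + 1 these are all the paths, so this is entry (0, s) of A^k; but it
    is a finite expression whose shape depends on k only. *)
Fixpoint path_weight A (k s : nat) : R[i] :=
  if k is k'.+1 then \sum_(t < k) path_weight A k' t * A t s else (s == 0)%:R.

Lemma path_weight_eq0 A m :
  (forall t s, (s <= m)%N -> (t.+1 < s)%N -> A t s = 0) ->
  forall k s, (s <= m)%N -> (k < s)%N -> path_weight A k s = 0.
Proof.
move=> A0 [|k] s sm ks /=; first by rewrite gtn_eqF.
rewrite big1 // => t _; rewrite A0 ?mulr0 //.
exact: leq_ltn_trans (ltn_ord t) ks.
Qed.

Lemma eq_path_weight A A' m :
  (forall t s, (t <= m)%N -> (s <= m)%N -> A t s = A' t s) ->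
  forall k s, (k <= m)%N -> (s <= m)%N ->
    path_weight A k s = path_weight A' k s.
Proof.
move=> AA; elim=> [//|k IH] s km sm /=; apply: eq_bigr => t _.
have tm : (t <= m)%N by apply: leq_trans (ltnW km); rewrite -ltnS.
by rewrite AA // IH // ltnW.
Qed.

Lemma cvg_path_weight (F : set_system nat) (FF : Filter F)
    (A : nat -> nat -> nat -> R[i]) (X : nat -> nat -> R[i]) :
  (forall t s, A n t s @[n --> F] --> X t s) ->
  forall k s, path_weight (A n) k s @[n --> F] --> path_weight X k s.
Proof.
move=> AX; elim=> [|k IH] s /=; first exact: cvg_cst.
elim: k.+1 => [|m IHm].
  rewrite big_ord0 (_ : (fun n => _) = fun=> 0); first exact: cvg_cst.
  by apply/funext => n; rewrite big_ord0.
rewrite big_ord_recr (_ : (fun n => _) = fun n =>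
    \sum_(t < m) path_weight (A n) k t * A n t s +
    path_weight (A n) k m * A n m s).
  by apply: (cvgD IHm (cvgM (IH m) (AX m s))).
by apply/funext => n; rewrite big_ord_recr.
Qed.

End PathWeight.

Section Series.
Variables (R : realType) (mu : {finite_measure set (borelC R) -> \bar R}).
Hypothesis mu_compact : compact (msupport mu).
Local Notation rad := (support_radius mu).

(** The part of A that lies above and to the left of (n, n), numbered backwards
    from there. *)
Definition window (A : nat -> nat -> R[i]) n t s := A (n - t)%N (n - s)%N.

(** The coefficient of 1 / z^(k+1) in p_(n-1)(z) / p_n(z), for k < n, when A is
    the Bergman shift matrix. *)
Definition ratio_coef (A : nat -> nat -> R[i]) n k : R[i] :=
  A n.+1 n * path_weight (window A n) k 0.

(** A path from n to n through an upper Hessenberg matrix descends by at most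
    one at each step, so after i steps it is at most i below n, and k <= n
    steps are too few to fall below the first row. *)
Lemma diag_power_path_weight p n k : is_orthonormal_polys mu p -> (k <= n)%N ->
  diag_power mu p n k =
  path_weight (fun t s => shift_entry mu p (n - t) (n - s)) k 0.
Proof.
move=> p_orth kn; set A := fun t s => _.
have A0 t s : (s <= n)%N -> (t.+1 < s)%N -> A t s = 0.
  by move=> sn ts; apply: (shift_hessenberg mu_compact p_orth); lia.
suff H : forall s, (s <= n)%N ->
    (truncated_shift mu p n ^+ k) ord_max (inord (n - s)) = path_weight A k s.
  rewrite -(H 0%N) // subn0 /diag_power; congr (_ _ _).
  by apply: val_inj; rewrite /= inordK.
elim: k kn => [|k IH] kn s sn.
  rewrite expr0 mxE /=; congr (_ %:R); congr nat_of_bool.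
  apply/eqP/eqP => [/(congr1 val)|->].
    by rewrite /= inordK; lia.
  by apply: val_inj; rewrite /= inordK subn0.
rewrite exprSr mxE (reindex_inj rev_ord_inj) /=.
rewrite (big_ord_widen n.+1 (fun t => path_weight A k t * A t s)); last first.
  exact: leq_trans kn _.
rewrite [RHS]big_mkcond /=; apply: eq_bigr => t _.
have tn : (t <= n)%N by rewrite -ltnS.
have -> : rev_ord t = inord (n - t).
  by apply: val_inj; rewrite /= inordK ?ltnS ?leq_subr.
rewrite IH ?(ltnW kn) // mxE !inordK ?ltnS ?leq_subr //.
by case: ltnP => // kt; rewrite (path_weight_eq0 A0) ?mul0r.
Qed.

(** The default value of orthopoly is zero, for which the matrix and the ratios
    vanish; both alternatives satisfy the expansion of the ratios. *)
Lemma orthopolyP :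
  is_orthonormal_polys mu (orthopoly mu) \/ orthopoly mu = fun=> 0.
Proof.
rewrite /orthopoly.
have [[p Hp]|H] := pselect (exists p, is_orthonormal_polys mu p).
  by left; apply: xgetPex; exists p.
by right; apply: xgetPN => p Hp; apply: H; exists p.
Qed.

Lemma bergman_shift0 : orthopoly mu = (fun=> 0) ->
  forall i j, bergman_shift mu i j = 0.
Proof.
move=> p0 i j; rewrite /bergman_shift p0.
rewrite (_ : (fun z => _) = fun z => 0 * 0); last first.
  by apply/funext => z; rewrite !horner0 mulr0 !mul0r.
rewrite cintegralZ // ?mul0r //; exact: test_function_cst.
Qed.

Lemma bergman_shift_bound i j : normc (bergman_shift mu i j) <= rad.
Proof.
have [orth|p0] := orthopolyP.
  exact: (normc_shift_entry mu_compact orth i.-1 j.-1).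
by rewrite bergman_shift0 // normc0 support_radius_ge0.
Qed.

Lemma poly_ratio_expansion (rho r : R) : rad <= rho -> 0 < rho -> rho < r ->
  exists2 C : R, 0 <= C &
  forall n K z, (0 < n)%N -> (K <= n)%N -> r <= normc z ->
    normc (poly_ratio mu n z -
           \sum_(k < K) ratio_coef (bergman_shift mu) n k / z ^+ k.+1) ^+ 2
    <= C * ((rho / r) ^+ K) ^+ 2.
Proof.
move=> rad_rho rho0 rho_r; have [orth|p0] := orthopolyP.
  have [C C0 HC] := ratio_expansion mu_compact orth rad_rho rho0 rho_r.
  exists C => // -[//|n] K z _ Kn rz; have := HC n K z rz.
  congr (normc (_ - _) ^+ 2 <= _); apply: eq_bigr => k _.
  have kn : (k <= n)%N by have := ltn_ord k; lia.
  rewrite (diag_power_path_weight orth kn) /ratio_coef; congr (_ * _ / _).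
  apply: (@eq_path_weight _ _ _ n) => // t s tn sn.
  by rewrite /window !subSn.
exists 0 => // n K z _ _ _; rewrite mul0r /poly_ratio p0 horner0 mul0r sub0r.
rewrite big1 ?oppr0 ?normc0 ?expr0n // => k _.
by rewrite /ratio_coef (bergman_shift0 p0) !mul0r.
Qed.

End Series.

(** * Diagonal extraction *)

Section Subsequences.

Lemma infinite_natP (N : set nat) :
  infinite_set N <-> forall m, exists2 n, N n & (m <= n)%N.
Proof.
split=> [infN m|H /finite_seqP[X NX]].
  apply: contrapT => H; apply: infN; apply: (sub_finite_set _ (finite_II m)).
  by move=> n Nn /=; rewrite ltnNge; apply/negP => mn; apply: H; exists n.
have [n] := H (\max_(i <- X) i).+1.
rewrite NX /= => nX; rewrite ltnNge; apply/negP; rewrite negbK.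
exact: leq_bigmax_seq.
Qed.

Lemma within_proper (N : set nat) :
  infinite_set N -> ProperFilter (within N \oo).
Proof.
move=> /infinite_natP H; split; last exact: within_filter.
by move=> [m _ mN]; have [n Nn mn] := H m; exact: mN n mn Nn.
Qed.

Lemma withinP (N : set nat) (P : set nat) :
  (\forall n \near within N \oo, P n) <->
  exists m, forall n, (m <= n)%N -> N n -> P n.
Proof.
split=> [[m _ mP]|[m mP]]; first by exists m => n mn Nn; exact: mP.
by exists m => // n mn Nn; exact: mP.
Qed.

Variable R : realType.

(** The limit is stated for values of u rather than as convergence of a filter,
    because this is the form in which countably many such limits are
    combined. *)
Lemma ultra_real_limit (U : set_system nat) (u : nat -> R) (b : R) :
  UltraFilter U -> (forall n, `|u n| <= b) ->
  exists x, forall e, 0 < e -> U [set n | `|x - u n| < e].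
Proof.
move=> FU ub.
have PU : ProperFilter U by exact: ultra_proper.
have PF : ProperFilter (u @ U) by exact: fmap_proper_filter.
have [|x [_ clx]] := @segment_compact R (- b) b (u @ U) PF.
  apply: (@filterS _ U _ setT); last exact: filterT.
  by move=> n _; rewrite /= in_itv /= -ler_norml.
exists x => e e0.
have [//|UC] := in_ultra_setVsetC [set n | `|x - u n| < e] FU.
have [y [/= Hy xy]] :=
  clx [set y | ~ (`|x - y| < e)] (ball x e) UC (nbhsx_ballx x e e0).
by case: Hy.
Qed.

Lemma ultra_complex_limit (U : set_system nat) (u : nat -> R[i]) (b : R) :
  UltraFilter U -> (forall n, normc (u n) <= b) ->
  exists x, forall e, 0 < e -> U [set n | normc (x - u n) < e].
Proof.
move=> FU ub.
have [x Hx] := ultra_real_limit FU (fun n => le_trans (normc_Re _) (ub n)).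
have [y Hy] := ultra_real_limit FU (fun n => le_trans (normc_Im _) (ub n)).
have PU : ProperFilter U by exact: ultra_proper.
exists (Complex x y) => e e0; have e2 : 0 < e / 2 by rewrite divr_gt0.
apply: filterS2 (Hx _ e2) (Hy _ e2) => n /=; case: (u n) => c d /= xc yd.
apply: le_lt_trans (normc_le_ReIm (Complex x y - Complex c d)) _.
by rewrite /=; lra.
Qed.

(** Being bounded, each g i has a limit x i along one ultrafilter that refines
    the tails of N.  For every m, the set of indices n >= m in N at which the
    first m + 1 sequences are within 1/(m + 1) of their limits belongs to the
    ultrafilter, so it has an element nu m; the range of nu is the desired
    set. *)
Lemma diagonal_extraction (g : nat -> nat -> R[i]) (b : R) (N : set nat) :
  infinite_set N -> (forall i n, normc (g i n) <= b) ->
  exists N', [/\ infinite_set N', N' `<=` N & exists x : nat -> R[i],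
    forall i, g i n @[n --> within N' \oo] --> x i].
Proof.
move=> infN gb.
have PN := within_proper infN.
have [U [FU NU]] := ultraFilterLemma PN.
have PU : ProperFilter U by exact: ultra_proper.
have [x Hx] := choice (fun i => ultra_complex_limit FU (gb i)).
have /choice[nu Hnu] : forall m, exists n, [/\ N n, (m <= n)%N &
    forall i, (i <= m)%N -> normc (x i - g i n) < m.+1%:R^-1].
  move=> m.
  have UN : U N by apply: NU; apply/withinP; exists 0%N.
  have Um : U [set n | (m <= n)%N] by apply: NU; apply/withinP; exists m.
  have Ug : U [set n | forall i : 'I_m.+1, normc (x i - g i n) < m.+1%:R^-1].
    by apply: filter_forall => i; apply: Hx; rewrite invr_gt0.
  have [n [[Nn mn] gn]] := filter_ex (filterI (filterI UN Um) Ug).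
  by exists n; split=> // i im; exact: (gn (Ordinal (im : (i < m.+1)%N))).
exists (range nu); split.
- apply/infinite_natP => m; exists (nu m); first by exists m.
  by have [] := Hnu m.
- by move=> _ [m _ <-]; have [] := Hnu m.
exists x => i; apply/cvg_normcP => e e0.
have [k ke] : exists k : nat, k.+1%:R^-1 < e.
  have [k _ /(_ k (leqnn k)) /=] := near_infty_natSinv_lt (PosNum e0).
  by exists k.
(* Beyond this bound, an element nu m of the range has m >= max(i, k). *)
apply/withinP; exists (\max_(j < maxn i k) nu j).+1 => n + [m _ nuE].
rewrite -nuE {n nuE}.
case: (ltnP m (maxn i k)) => [mk|km _].
  by rewrite ltnNge (leq_bigmax (Ordinal mk)).
have [_ _ gm] := Hnu m; rewrite geq_max in km; case/andP: km => im km.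
apply: lt_le_trans (gm i im) _; apply: le_trans (ltW ke).
by rewrite lef_pV2 ?posrE // ler_nat.
Qed.

End Subsequences.

(** * Right limits *)

Section RightLimits.
Variable R : realType.
Implicit Types (A : nat -> nat -> R[i]) (X : int -> int -> R[i]) (N : set nat).

Definition right_limit_along N A X :=
  forall m, centered_block A n m @[n --> within N \oo] --> centered_block0 X m.

Lemma eventually_eq_cvg N (u v : nat -> R[i]) (l : R[i]) m :
  (forall n, (m <= n)%N -> u n = v n) ->
  u n @[n --> within N \oo] --> l -> v n @[n --> within N \oo] --> l.
Proof.
move=> uv /cvg_normcP ul; apply/cvg_normcP => e /ul /withinP[k Hk].
apply/withinP; exists (maxn k m) => n; rewrite geq_max => /andP[kn mn] Nn.
by rewrite -uv //; exact: Hk.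
Qed.

Lemma right_limit_entry N A X m (i j : nat) :
  right_limit_along N A X -> (i <= m.*2)%N -> (j <= m.*2)%N ->
  A (n - m + i)%N (n - m + j)%N @[n --> within N \oo]
    --> X (i%:Z - m%:Z) (j%:Z - m%:Z).
Proof.
move=> HX im jm; have /cvg_mxP := HX m.
move=> /(_ (Ordinal (im : i < m.*2.+1)%N) (Ordinal (jm : j < m.*2.+1)%N)).
by rewrite mxE; under eq_fun do rewrite mxE.
Qed.

(** What ratio_coef becomes when the matrix is replaced by a right limit X,
    with the position (n, n) of the matrix at (0, 0) of X. *)
Definition limit_coef X k : R[i] :=
  X 1 0 * path_weight (fun t s => X (- t%:Z) (- s%:Z)) k 0.

Lemma right_limit_coef N A X k : right_limit_along N A X ->
  ratio_coef A n k @[n --> within N \oo] --> limit_coef X k.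
Proof.
move=> HX; apply: cvgM.
  have := @right_limit_entry N A X 1 2 1 HX isT isT.
  by apply: (@eventually_eq_cvg _ _ _ _ 1%N) => n n1; congr (A _ _); lia.
apply: cvg_path_weight => t s; pose m := maxn t s.
have tm : (t <= m)%N by exact: leq_maxl.
have sm : (s <= m)%N by exact: leq_maxr.
have := @right_limit_entry N A X m (m - t) (m - s) HX.
have -> : (m - t)%N%:Z - m%:Z = - t%:Z by lia.
have -> : (m - s)%N%:Z - m%:Z = - s%:Z by lia.
move=> H; apply: (eventually_eq_cvg _ (H _ _)); [|lia|lia].
by instantiate (1 := m) => n mn; rewrite /window; congr (A _ _); lia.
Qed.

(** Diagonal extraction applied to the countably many sequences of entries
    A (n + a) (n + c), for a and c in int. *)
Lemma right_limit_extraction A (b : R) N : infinite_set N ->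
  (forall i j, normc (A i j) <= b) ->
  exists N' X, [/\ infinite_set N', N' `<=` N & right_limit_along N' A X].
Proof.
move=> infN Ab.
(* For given a, the sum n + a is negative for finitely many n only, so the
   absolute value there does not affect limits. *)
pose idx (n : nat) (a : int) : nat := `|(n%:Z + a)%R|%N.
pose g q n := if @unpickle (int * int)%type q is Some ab
  then A (idx n ab.1) (idx n ab.2) else 0.
have b0 : 0 <= b by apply: le_trans (Ab 0%N 0%N); exact: normc_ge0.
have gb q n : normc (g q n) <= b.
  by rewrite /g; case: unpickle => [ab|]; rewrite ?normc0.
have [N' [infN' NN' [x Hx]]] := diagonal_extraction infN gb.
exists N', (fun a c => x (pickle (a, c))); split=> // m.
apply/cvg_mxP => i j; rewrite mxE.
apply: (eventually_eq_cvg _ (Hx _)); instantiate (1 := m) => n mn.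
by rewrite /g pickleK mxE /idx /=; congr (A _ _); lia.
Qed.

End RightLimits.

(** * Right limits determine limits of ratios *)

Section Main.
Variable R : realType.
Implicit Types (X : int -> int -> R[i]) (N : set nat).

Definition limit_partial_sum X K (z : R[i]) : R[i] :=
  \sum_(k < K) limit_coef X k / z ^+ k.+1.

Lemma partial_sum_cvg N (c : nat -> nat -> R[i]) (l : nat -> R[i]) (r e : R) K :
  0 < r -> 0 < e ->
  (forall k, c n k @[n --> within N \oo] --> l k) ->
  \forall n \near within N \oo, forall z, r <= normc z ->
    normc (\sum_(k < K) c n k / z ^+ k.+1 - \sum_(k < K) l k / z ^+ k.+1) < e.
Proof.
move=> r0 e0 cl; elim: K e e0 => [|K IH] e e0.
  by apply: nearW => n z _; rewrite !big_ord0 subrr normc0.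
have e2 : 0 < e / 2 by rewrite divr_gt0.
have er : 0 < e / 2 * r ^+ K.+1 by rewrite mulr_gt0 // exprn_gt0.
have /cvg_normcP/(_ _ er) lastK := cl K.
apply: filterS2 (IH _ e2) lastK => n H1 H2 z rz.
rewrite !big_ord_recr /= opprD addrACA -mulrBl.
apply: le_lt_trans (le_normcD _ _) _.
rewrite [ltRHS](splitr e); apply: ltrD; first exact: H1.
have zr : 0 < normc z by exact: lt_le_trans rz.
rewrite normcM normcV normcX normcB ltr_pdivrMr ?exprn_gt0 //.
apply: lt_le_trans H2 _; rewrite ler_wpM2l ?(ltW e2) //.
by rewrite lerXn2r ?nnegrE ?normc_ge0 ?(ltW r0).
Qed.

(** One partial sum, of a length that does not depend on n, approximates all
    ratios along N up to e: the tail is small uniformly in n, and the finitely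
    many coefficients that remain converge. *)
Lemma poly_ratio_near_series (mu : {finite_measure set (borelC R) -> \bar R})
    N X (r e : R) :
  compact (msupport mu) -> right_limit_along N (bergman_shift mu) X ->
  support_radius mu < r -> 0 < e ->
  exists K0, forall K, (K0 <= K)%N ->
    \forall n \near within N \oo, forall z, r <= normc z ->
      normc (poly_ratio mu n z - limit_partial_sum X K z) < e.
Proof.
move=> mu_compact HX radr e0.
have rad0 := support_radius_ge0 mu.
have r0 : 0 < r by exact: le_lt_trans radr.
pose rho := (support_radius mu + r) / 2.
have rad_rho : support_radius mu <= rho by rewrite /rho; lra.
have rho_r : rho < r by rewrite /rho; lra.
have rho0 : 0 < rho by rewrite /rho; lra.
have [C C0 HC] := poly_ratio_expansion mu_compact rad_rho rho0 rho_r.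
have q1 : `|rho / r| < 1.
  rewrite ger0_norm; first by rewrite ltr_pdivrMr // mul1r.
  by rewrite divr_ge0 // ltW.
have e2 : 0 < e / 2 by rewrite divr_gt0.
have [K0 HK0] : exists K0, forall K, (K0 <= K)%N ->
    C * ((rho / r) ^+ K) ^+ 2 < (e / 2) ^+ 2.
  (* The factor 1 + C instead of C keeps d positive and finite when C = 0. *)
  pose d := e / 2 / (1 + C).
  have C1 : 0 < 1 + C by rewrite ltr_pwDl.
  have d0 : 0 < d by rewrite divr_gt0.
  have /cvgrPdist_lt/(_ _ d0)[K0 _ HK0] := cvg_expr q1.
  exists K0 => K /HK0 /=; rewrite sub0r normrN => qd.
  have q0 : 0 <= (rho / r) ^+ K by rewrite exprn_ge0 // divr_ge0 // ltW.
  rewrite ger0_norm // in qd.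
  have qd2 : ((rho / r) ^+ K) ^+ 2 < d ^+ 2.
    by rewrite ltrXn2r // ?nnegrE // ltW.
  have -> : (e / 2) ^+ 2 = (1 + C) ^+ 2 * d ^+ 2.
    by rewrite /d -exprMn; congr (_ ^+ 2); field; rewrite gt_eqF.
  have d2 : 0 < d ^+ 2 by exact: exprn_gt0.
  have CC : C < (1 + C) ^+ 2 by nra.
  apply: (@le_lt_trans _ _ (C * d ^+ 2)); first by rewrite ler_wpM2l // ltW.
  by rewrite ltr_pM2r.
exists K0 => K KK; have coefs k := @right_limit_coef R N _ X k HX.
have /withinP[n0 Hn0] := partial_sum_cvg K r0 e2 coefs.
apply/withinP; exists (maxn n0 (maxn 1 K)) => n.
rewrite !geq_max => /and3P[nn0 n1 nK] Nn z rz.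
apply: le_lt_trans (normc_triangle _ (\sum_(k < K)
  ratio_coef (bergman_shift mu) n k / z ^+ k.+1) _) _.
rewrite [ltRHS](splitr e); apply: ltrD; last exact: Hn0.
have := le_lt_trans (HC n K z n1 nK rz) (HK0 K KK).
by rewrite ltr_pXn2r // ?nnegrE ?normc_ge0 ?(ltW e2).
Qed.

(** A limit f of ratios of mu along N and the ratios of nu along a suitable
    subsequence are both close to the same partial sums, namely those of the
    series of a right limit common to mu and nu.  On the compact set K, the
    modulus has a minimum, which exceeds both support radii and serves as the
    radius r of the uniform estimates. *)
Lemma ratio_limits_sub (mu nu : {finite_measure set (borelC R) -> \bar R})
    (D : set R[i]) :
  compact (msupport mu) -> compact (msupport nu) ->
  (forall z, D z -> support_radius mu < normc z) ->
  (forall z, D z -> support_radius nu < normc z) ->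
  bergman_right_limits mu `<=` bergman_right_limits nu ->
  ratio_limits mu D `<=` ratio_limits nu D.
Proof.
move=> mu_c nu_c Dmu Dnu sub f [fD [N infN fN]]; split=> //.
have [N' [X [infN' NN' XN']]] :=
  right_limit_extraction infN (bergman_shift_bound mu_c).
have [N2 infN2 XN2] : bergman_right_limits nu X by apply: sub; exists N'.
exists N2 => // K cK KD; apply/uniform_normcP => e e0.
have [->|/set0P K0] := eqVneq K set0; first exact: nearW.
have [c /set_mem Kc cmin] : exists2 c, c \in K &
    forall t, t \in K -> normc c <= normc t.
  apply: compact_EVT_min => //; apply: continuous_subspaceT.
  exact: continuous_normc.
have e3 : 0 < e / 3 by rewrite divr_gt0.
have [K1 HK1] := poly_ratio_near_series mu_c XN' (Dmu _ (KD _ Kc)) e3.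
have [K2 HK2] := poly_ratio_near_series nu_c XN2 (Dnu _ (KD _ Kc)) e3.
pose k := maxn K1 K2.
have {}HK1 := HK1 k (leq_maxl _ _); have {}HK2 := HK2 k (leq_maxr _ _).
have /uniform_normcP/(_ _ e3)/withinP[m Hm] := fN K cK KD.
have fX z : K z -> normc (f z - limit_partial_sum X k z) < e / 3 + e / 3.
  move=> Kz; case/withinP : HK1 => m' Hm'.
  have [n N'n] := (infinite_natP N').1 infN' (maxn m m').
  rewrite geq_max => /andP[mn m'n].
  apply: le_lt_trans (normc_triangle _ (poly_ratio mu n z) _) _.
  apply: ltrD; first by apply: Hm => //; exact: NN'.
  by apply: Hm' => //; apply: cmin; exact: mem_set.
apply: filterS HK2 => n Hn z Kz.
apply: le_lt_trans (normc_triangle _ (limit_partial_sum X k z) _) _.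
have H1 := fX z Kz; have := Hn z (cmin z (mem_set Kz)); rewrite normcB => H2.
by lra.
Qed.

End Main.

Theorem corollary1p4 (R : realType)
  (mu nu : {finite_measure set (borelC R) -> \bar R})
  (mu_compact : compact (msupport mu))
  (mu_infinite : infinite_set (msupport mu))
  (nu_compact : compact (msupport nu))
  (nu_infinite : infinite_set (msupport nu)) :
  bergman_right_limits mu = bergman_right_limits nu ->
  ratio_limits mu (common_domain mu nu) = ratio_limits nu (common_domain mu nu).
Proof.
move=> /seteqP[subB supB].
have Dmu z : common_domain mu nu z -> support_radius mu < normc z.
  by rewrite /common_domain /= gt_max => /andP[].
have Dnu z : common_domain mu nu z -> support_radius nu < normc z.
  by rewrite /common_domain /= gt_max => /andP[].
apply/seteqP; split.
  exact: (ratio_limits_sub mu_compact nu_compact Dmu Dnu subB).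
exact: (ratio_limits_sub nu_compact mu_compact Dnu Dmu supB).
Qed.
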